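(* Fix an integer $r\geq 0$. Then, for formal variables $x,z$ (or considering $x,z\in\mathbb{C}$ in a small disc around the origin), $$\prod_{k\geq0}\left(1-x^{k}z\right)^{(-1)^{k+1}\binom{r}{k}}=\sum_{n\geq0}\sum_{\sigma\in S_{n}}\frac{z^{n}}{n!}\det(I_{n}-xM_{\sigma})^{r}.$$
   Context: $S_n$ is the symmetric group on $n$ letters, $I_n$ is the $n\times n$ identity matrix and $M_\sigma$ is the $n\times n$ permutation matrix associated to $\sigma\in S_n$. For $n=0$ the group $S_0$ is trivial and the determinant of the empty matrix is $1$, so the $n=0$ term equals $1$. As a formal identity it is one between power series in $z$ (with coefficients polynomials in $x$). *)

(* Defs.v *)
From HB Require Import structures.
From mathcomp Require Import all_boot all_order all_algebra all_fingroup.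
From mathcomp Require Import complex.
From mathcomp Require Import all_classical all_reals all_analysis.

Set Implicit Arguments.
Unset Strict Implicit.
Unset Printing Implicit Defensive.

Import Order.TTheory GRing.Theory Num.Theory.
Import numFieldNormedType.Exports.

Local Open Scope ring_scope.

(* [fps A] is A[[z]]: the series \sum_n a_n z^n is [Fps a], without any
   convergence requirement, and products are Cauchy products. *)
Record fps (A : Type) := Fps { fps_coef : nat -> A }.

HB.instance Definition _ (A : Type) := [isNew for @fps_coef A].
HB.instance Definition _ (A : choiceType) := [Choice of fps A by <:].

Lemma fpsP (A : Type) (f g : fps A) : fps_coef f =1 fps_coef g <-> f = g.
Proof. by case: f g => [f] [g]; split=> [/funext /= ->|[->]]. Qed.

Section FpsZmodule.
Variable A : zmodType.
Implicit Types f g h : fps A.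

Definition fps_zero : fps A := Fps (fun=> 0).
Definition fps_opp f : fps A := Fps (fun n => - fps_coef f n).
Definition fps_add f g : fps A := Fps (fun n => fps_coef f n + fps_coef g n).

Fact fps_addA : associative fps_add.
Proof. by move=> f g h; apply/fpsP => n; rewrite /= addrA. Qed.
Fact fps_addC : commutative fps_add.
Proof. by move=> f g; apply/fpsP => n; rewrite /= addrC. Qed.
Fact fps_add0 : left_id fps_zero fps_add.
Proof. by move=> f; apply/fpsP => n; rewrite /= add0r. Qed.
Fact fps_addN : left_inverse fps_zero fps_opp fps_add.
Proof. by move=> f; apply/fpsP => n; rewrite /= addNr. Qed.

HB.instance Definition _ :=
  GRing.isZmodule.Build (fps A) fps_addA fps_addC fps_add0 fps_addN.

End FpsZmodule.

Section FpsRing.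
Variable A : comNzRingType.
Implicit Types f g h : fps A.

Definition fps_const (a : A) : fps A := Fps (fun n => if n == 0%N then a else 0).
Definition fps_var : fps A := Fps (fun n => (n == 1%N)%:R).
Definition fps_mul f g : fps A :=
  Fps (fun n => \sum_(i < n.+1) fps_coef f i * fps_coef g (n - i)%N).

Definition fps_trunc n f : {poly A} := \poly_(i < n.+1) fps_coef f i.

Lemma fps_coef_mul_trunc n m f g : (m <= n)%N ->
  fps_coef (fps_mul f g) m = (fps_trunc n f * fps_trunc n g)`_m.
Proof.
move=> mn; rewrite coefM /=; apply: eq_bigr => i _; rewrite !coef_poly.
by rewrite !ltnS (leq_trans (leq_subr _ _) mn) (leq_trans _ mn) // -ltnS.
Qed.

Fact fps_mulC : commutative fps_mul.
Proof.
by move=> f g; apply/fpsP => n; rewrite !(@fps_coef_mul_trunc n) // mulrC.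
Qed.

Fact fps_mulA : associative fps_mul.
Proof.
move=> f g h; apply/fpsP => n.
have truncE k f' : (k <= n)%N -> fps_coef f' k = (fps_trunc n f')`_k.
  by move=> kn; rewrite coef_poly ltnS kn.
transitivity ((fps_trunc n f * (fps_trunc n g * fps_trunc n h))`_n).
  rewrite coefM; apply: eq_bigr => i _.
  by rewrite (@fps_coef_mul_trunc n) ?leq_subr // truncE // -ltnS.
rewrite mulrA coefM; symmetry; apply: eq_bigr => i _.
by rewrite (@fps_coef_mul_trunc n) -1?ltnS // truncE ?leq_subr.
Qed.

Fact fps_mul1 : left_id (fps_const 1) fps_mul.
Proof.
move=> f; apply/fpsP => n; rewrite /= big_ord_recl /= mul1r subn0.
by rewrite big1 ?addr0 // => i _; rewrite mul0r.
Qed.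

Fact fps_mulD : left_distributive fps_mul (@fps_add A).
Proof.
move=> f g h; apply/fpsP => n; rewrite /= -big_split /=.
by apply: eq_bigr => i _; rewrite mulrDl.
Qed.

Fact fps_oner_neq0 : fps_const 1 != 0.
Proof.
by apply/eqP => /fpsP /(_ 0%N) /= /eqP; rewrite oner_eq0.
Qed.

HB.instance Definition _ := GRing.Zmodule_isComNzRing.Build (fps A)
  fps_mulA fps_mulC fps_mul1 fps_mulD fps_oner_neq0.

End FpsRing.

Section FpsUnit.
Variable A : comUnitRingType.
Implicit Types f g h : fps A.

(* The first n coefficients of f^-1, read off coefficientwise from f * g = 1. *)
Fixpoint fps_inv_coefs f n : seq A :=
  if n is m.+1 then
    let s := fps_inv_coefs f m in
    rcons s ((fps_coef f 0)^-1 *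
             ((m == 0%N)%:R - \sum_(i < m) fps_coef f (m - i)%N * s`_i))
  else [::].

Definition fps_unit : pred (fps A) :=
  [pred f : fps A | fps_coef f 0 \is a GRing.unit].

Definition fps_inv f : fps A :=
  if fps_unit f then Fps (fun n => (fps_inv_coefs f n.+1)`_n) else f.

Lemma size_fps_inv_coefs f n : size (fps_inv_coefs f n) = n.
Proof. by elim: n => //= n IHn; rewrite size_rcons IHn. Qed.

Lemma nth_fps_inv_coefs f n i : (i < n)%N ->
  (fps_inv_coefs f n)`_i = (fps_inv_coefs f i.+1)`_i.
Proof.
elim: n => // n IHn; rewrite ltnS leq_eqVlt => /predU1P[-> //|lt_in].
by rewrite [LHS]/= nth_rcons size_fps_inv_coefs lt_in IHn.
Qed.

Lemma fps_inv_coefE f n : fps_unit f ->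
  fps_coef (fps_inv f) n = (fps_coef f 0)^-1 *
    ((n == 0%N)%:R - \sum_(i < n) fps_coef f (n - i)%N * fps_coef (fps_inv f) i).
Proof.
rewrite /fps_inv => fU; rewrite fU [LHS]/= nth_rcons size_fps_inv_coefs ltnn eqxx.
congr (_ * (_ - _)); apply: eq_bigr => i _; congr (_ * _).
by rewrite nth_fps_inv_coefs.
Qed.

Fact fps_mulVr : {in fps_unit, left_inverse 1 fps_inv *%R}.
Proof.
move=> f fU; apply/fpsP => n; rewrite [LHS]/= big_ord_recr /= subnn.
rewrite [X in _ + X * _]fps_inv_coefE // mulrAC mulVr ?mul1r //.
under eq_bigr do rewrite mulrC.
by rewrite addrCA subrr addr0; case: eqP.
Qed.

Fact fps_unitPl f g : g * f = 1 -> fps_unit f.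
Proof.
move=> /fpsP /(_ 0%N); rewrite /= big_ord1 /= subn0 => gf1.
by apply/unitrP; exists (fps_coef g 0); split=> //; rewrite mulrC.
Qed.

Fact fps_inv_out : {in [predC fps_unit], fps_inv =1 id}.
Proof. by move=> f /negPf fNU; rewrite /fps_inv [fps_unit f]fNU. Qed.

HB.instance Definition _ := GRing.ComNzRing_hasMulInverse.Build (fps A)
  fps_mulVr fps_unitPl fps_inv_out.

End FpsUnit.

(* Main.v *)
From HB Require Import structures.
Require Import Defs.
From mathcomp Require Import all_boot all_order all_algebra all_fingroup.
From mathcomp Require Import complex.
From mathcomp Require Import all_classical all_reals all_analysis.
From mathcomp Require Import ring.

(* Let [D n] be the sum of det(1 - x M_s)^r over [s] in S_n. Deleting the points
   of the cycle of a marked element one at a time (a Schur complement on the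
   matrix side) gives
     D (n+1) = \sum_(k <= n) n!/(n-k)! (1 - x^(k+1))^r D (n-k),
   i.e. the series \sum_n D n z^n / n! has logarithmic derivative
   \sum_n (1 - x^(n+1))^r z^n. Expanding by the binomial formula, this is also
   the logarithmic derivative of the product, so both series agree.
   Analytically, multiplying a power series by (1 - a z)^(+-1) with |a z| < 1
   preserves convergence at [z] and multiplies the sum by the same factor, so
   the formal product expansion can be evaluated for |x|, |z| < 1. *)

Set Implicit Arguments.
Unset Strict Implicit.
Unset Printing Implicit Defensive.

Import Order.TTheory GRing.Theory Num.Theory.
Import numFieldNormedType.Exports.

Local Open Scope classical_set_scope.
Local Open Scope ring_scope.

(** * Permutation determinants and the recursion for their power sums *)

Lemma sum_perm_lift0 (V : nmodType) n (F : 'S_n.+1 -> V) :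
  \sum_(s : 'S_n.+1) F s
  = \sum_(i : 'I_n.+1) \sum_(s : 'S_n) F (tperm 0 i * lift0_perm s)%g.
Proof.
(* The point [i] is recovered as the preimage of 0; injectivity and a cardinality count then make
   [h] a bijection. *)
pose h (u : 'I_n.+1 * 'S_n) := (tperm 0%R u.1 * lift0_perm u.2)%g.
have h_inj : injective h.
  move=> [i s] [j t] /= eq_h.
  have vE (k : 'I_n.+1) (v : 'S_n) : h (k, v) k = 0.
    by rewrite /h permM /= tpermR lift0_perm0.
  have eq_ij : i = j.
    by apply: (@perm_inj _ (h (j, t))); rewrite vE -eq_h vE.
  move: eq_h; rewrite eq_ij => /mulgI eq_st; congr (_, _).
  apply/permP => k; apply: (@lift_inj _ 0).
  by rewrite -!lift0_perm_lift eq_st.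
rewrite pair_big /= (reindex h) //=; apply: onW_bij.
by apply: inj_card_bij => //; rewrite card_prod card_ord !card_Sn factS.
Qed.

Section DetPerm.
Variable R : comPzRingType.

Lemma det_ul1_block n (u : 'rV[R]_n) (v : 'cV_n) (B : 'M[R]_n) :
  \det (block_mx (1%:M : 'M[R]_1) u v B) = \det (B - v *m u).
Proof.
have <- : block_mx (1%:M : 'M[R]_1) 0 v 1%:M *m block_mx 1%:M u 0 (B - v *m u)
   = block_mx 1%:M u v B.
  by rewrite mulmx_block !mul1mx !mul0mx !mulmx1 !addr0 addrC subrK.
by rewrite det_mulmx det_lblock det_ublock !det1 !mul1r.
Qed.

(** Each row has its own weight because deleting a point of a cycle merges two weights into their
    product. *)
Definition det_perm n (d : 'I_n -> R) (s : 'S_n) : R :=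
  \det (1%:M - \matrix_(i, j) (d i *+ (s i == j))).

Lemma det_perm_const n (x : R) (s : 'S_n) :
  \det (1%:M - x *: perm_mx s) = det_perm (fun=> x) s.
Proof.
by congr (\det (_ - _)); apply/matrixP => i j; rewrite !mxE mulr_natr.
Qed.

Lemma det_perm_conj n (d : 'I_n -> R) (s t : 'S_n) :
  det_perm d (s ^ t)%g = det_perm (d \o t) s.
Proof.
rewrite /det_perm; set A := (X in \det X); set B := (X in _ = \det X).
have -> : B = perm_mx t *m A *m perm_mx t^-1.
  rewrite -row_permE -col_permE; apply/matrixP => i j.
  by rewrite !mxE (inj_eq perm_inj) permJ (inj_eq perm_inj).
rewrite !det_mulmx mulrAC -det_mulmx -perm_mxM mulgV perm_mx1 det1.
by rewrite mul1r.
Qed.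

Lemma det_perm_fix n (d : 'I_n.+1 -> R) (s : 'S_n) :
  det_perm d (lift0_perm s) = (1 - d 0) * det_perm (d \o lift 0) s.
Proof.
rewrite /det_perm; set A := (X in \det X); set B := (X in _ = _ * \det X).
have -> : \det A = \det (block_mx ((1 - d 0)%:M : 'M[R]_1) 0 0 B).
  congr (\det _); apply/matrixP => i j; rewrite !mxE !split1 /=.
  case: (unliftP 0 i) => [i'|] -> /=; rewrite !mxE split1 /=;
  case: (unliftP 0 j) => [j'|] ->; rewrite /= ?lift0_perm0 ?lift0_perm_lift ?mxE //.
  - exact: subr0.
  - exact: subr0.
by rewrite det_ublock det_scalar1.
Qed.

(* Composing with the transposition inserts [0] just after [i] in its cycle. *)
Lemma det_perm_insert n (d : 'I_n.+1 -> R) (i : 'I_n) (s : 'S_n) :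
  det_perm d (tperm 0 (lift 0 i) * lift0_perm s)%g
  = det_perm (fun j => if j == i then d 0 * d (lift 0 i) else d (lift 0 j)) s.
Proof.
rewrite /det_perm; set A := (X in \det X); set B := (X in _ = \det X).
pose u : 'rV[R]_n := \row_j - (d 0 *+ (s i == j)).
pose v : 'cV[R]_n := \col_j - (d (lift 0 i) *+ (j == i)).
(* The permutation sends [lift 0 i] to 0 and 0 to [lift 0 (s i)], so row [i] of [C] keeps only its
   diagonal 1; the correction [v *m u] restores the merged weight at [s i]. *)
pose C : 'M[R]_n :=
  \matrix_(j, k) ((j == k)%:R - if j == i then 0 else d (lift 0 j) *+ (s j == k)).
have -> : \det A = \det (block_mx (1%:M : 'M[R]_1) u v C).
  congr (\det _); apply/matrixP => j k; rewrite !mxE !split1 /=.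
  case: (unliftP 0 j) => [j'|] -> /=; rewrite !mxE split1 /=;
  case: (unliftP 0 k) => [k'|] ->; rewrite /= !mxE permM.
  - rewrite !(inj_eq lift_inj); have [->|ji] := eqVneq j' i.
      by rewrite tpermR lift0_perm0 (negPf (neq_lift _ _)).
    rewrite tpermD ?neq_lift ?(inj_eq lift_inj) 1?eq_sym //.
    by rewrite lift0_perm_lift (inj_eq lift_inj).
  - rewrite sub0r.
    have [->|ji] := eqVneq j' i; first by rewrite tpermR lift0_perm0.
    rewrite tpermD ?neq_lift ?(inj_eq lift_inj) 1?eq_sym //.
    by rewrite lift0_perm_lift.
  - by rewrite sub0r tpermL lift0_perm_lift (inj_eq lift_inj).
  - rewrite tpermL lift0_perm_lift; exact: subr0.
rewrite det_ul1_block; congr (\det _); apply/matrixP => j k.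
rewrite !mxE big_ord1 !mxE; have [->|ji] := eqVneq j i.
  rewrite subr0 mulrNN mulrnAr mulr1n; congr (_ - _ *+ _); exact: mulrC.
by rewrite mulr0n oppr0 mul0r subr0.
Qed.

Variables (r : nat) (x : R).

Definition det_perm_sum n : R := \sum_(s : 'S_n) det_perm (fun=> x) s ^+ r.

(* The cycle through the marked point [0] is weighted as if it had
   additional length: its marked edge carries [y] instead of [x]. *)
Definition marked_sum n (y : R) : R :=
  \sum_(s : 'S_n.+1) det_perm (fun i => if i == 0 then y else x) s ^+ r.

(** Split on the preimage of 0. If 0 is fixed, a factor [1 - y] comes out; otherwise contracting 0
    gives its predecessor the weight [y * x], and conjugation moves that point to 0, so all [n]
    choices contribute equally. *)
Lemma marked_sum_rec n y :
  marked_sum n y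
  = (1 - y) ^+ r * det_perm_sum n
    + (if n is m.+1 then marked_sum m (y * x) else 0) *+ n.
Proof.
rewrite /marked_sum sum_perm_lift0 big_ord_recl /=; congr (_ + _).
  rewrite /det_perm_sum mulr_sumr; apply: eq_bigr => s _.
  rewrite tperm1 mul1g det_perm_fix exprMn eqxx; congr (_ * _ ^+ _).
case: n => [|n]; first by rewrite big_ord0.
set S := (X in _ = X *+ _).
transitivity (\sum_(i < n.+1) S); last by rewrite sumr_const card_ord.
apply: eq_bigr => i _; rewrite {}/S (reindex_inj (conjg_inj (tperm 0 i))).
apply: eq_bigr => s _; congr (_ ^+ r).
rewrite det_perm_insert det_perm_conj /det_perm; congr (\det (_ - _)).
apply/matrixP => j k; rewrite !mxE; congr (_ *+ _) => /=.
by rewrite -[X in _ == X](tpermL 0 i) (inj_eq perm_inj).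
Qed.

(** Here [k] counts the other points on the cycle through 0, and [n ^_ k] the ways to choose them in
    order. *)
Lemma marked_sumE n y :
  marked_sum n y =
  \sum_(k < n.+1) (1 - y * x ^+ k) ^+ r * det_perm_sum (n - k) *+ n ^_ k.
Proof.
elim: n y => [|n IHn] y; rewrite marked_sum_rec.
  by rewrite mul0rn addr0 big_ord1 ffactn0 subn0 expr0 mulr1.
rewrite IHn [RHS]big_ord_recl ffactn0 expr0 mulr1; congr (_ + _).
rewrite -sumrMnl; apply: eq_bigr => k _; rewrite lift0 subSS -mulrnA.
by rewrite ffactnS mulnC exprS mulrA.
Qed.

Lemma det_perm_sum_rec n :
  det_perm_sum n.+1 =
  \sum_(k < n.+1) (1 - x ^+ k.+1) ^+ r * det_perm_sum (n - k) *+ n ^_ k.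
Proof.
transitivity (marked_sum n x).
  apply: eq_bigr => s _; congr (\det (_ - _) ^+ r).
  by apply/matrixP => i j; rewrite !mxE if_same.
by rewrite marked_sumE; under eq_bigr do rewrite -exprS.
Qed.

End DetPerm.

(** * Logarithmic derivatives and the formal identity *)

Section FpsLog.
Variable A : comUnitRingType.
Implicit Types (f g h : fps A) (a : A).

Definition fps_deriv f : fps A := Fps (fun n => fps_coef f n.+1 *+ n.+1).

Lemma fps_coefM0 f g : fps_coef (f * g) 0 = fps_coef f 0 * fps_coef g 0.
Proof. exact: big_ord1. Qed.

(** Coefficient [n] only involves coefficients up to [n.+1], so the Leibniz rule transfers from
    truncated polynomials. *)
Lemma fps_derivM f g : fps_deriv (f * g) = fps_deriv f * g + f * fps_deriv g.
Proof.
apply/fpsP => n; set F := fps_trunc n.+1 f; set G := fps_trunc n.+1 g.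
have truncE h i : (i <= n.+1)%N -> fps_coef h i = (fps_trunc n.+1 h)`_i.
  by move=> le_in; rewrite coef_poly ltnS le_in.
transitivity ((F * G)^`()`_n).
  by rewrite coef_deriv; congr (_ *+ _); apply: fps_coef_mul_trunc.
rewrite derivM coefD !coefM.
have le_in (i : 'I_n.+1) : (i <= n)%N by rewrite -ltnS.
congr (_ + _); apply: eq_bigr => i _ /=.
  by rewrite coef_deriv -!truncE ?ltnS // ltnW // ltnS leq_subr.
by rewrite coef_deriv -!truncE ?ltnS ?leq_subr // ltnW.
Qed.

Lemma fps_deriv1 : fps_deriv 1 = 0.
Proof. by apply/fpsP => n; rewrite /= mul0rn. Qed.

(* [g] is the logarithmic derivative of [f], for [f] in [1 + z A[[z]]]. *)
Definition fps_logd f g := fps_coef f 0 = 1 /\ fps_deriv f = f * g.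

Lemma fps_logd1 : fps_logd 1 0.
Proof. by split; rewrite ?mulr0 ?fps_deriv1. Qed.

Lemma fps_logdM f g f' g' :
  fps_logd f g -> fps_logd f' g' -> fps_logd (f * f') (g + g').
Proof.
move=> [f1 df] [f'1 df']; split; first by rewrite fps_coefM0 f1 f'1 mulr1.
by rewrite fps_derivM df df' mulrDr mulrAC mulrA.
Qed.

Lemma fps_logd_unit f g : fps_logd f g -> f \is a GRing.unit.
Proof.
move=> [f1 _]; change (fps_coef f 0 \is a GRing.unit).
by rewrite f1 unitr1.
Qed.

Lemma fps_logdV f g : fps_logd f g -> fps_logd f^-1 (- g).
Proof.
move=> log_fg; have Uf := fps_logd_unit log_fg.
have [f1 df] := log_fg; split.
  by have := fps_coefM0 f f^-1; rewrite divrr // f1 mul1r.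
apply: (mulrI Uf); rewrite mulrA divrr // mul1r.
have := fps_derivM f f^-1; rewrite divrr // fps_deriv1 df mulrAC divrr // mul1r.
by move/esym/eqP; rewrite addrC addr_eq0 => /eqP.
Qed.

Lemma fps_logdX f g (e : int) : fps_logd f g -> fps_logd (f ^ e) (g *~ e).
Proof.
move=> log_fg.
have logX n : fps_logd (f ^+ n) (g *+ n).
  elim: n => [|n IHn]; first exact: fps_logd1.
  by rewrite exprS mulrS; apply: fps_logdM.
case: e => n; first exact: logX.
rewrite NegzE mulrNz -exprnN; exact: fps_logdV.
Qed.

Lemma fps_logd_prod n (f g : nat -> fps A) :
  (forall k, fps_logd (f k) (g k)) ->
  fps_logd (\prod_(k < n) f k) (\sum_(k < n) g k).
Proof.
move=> log_fg; apply: (big_ind2 fps_logd) => //; first exact: fps_logd1.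
by move=> *; apply: fps_logdM.
Qed.

(** The quotient [f / f'] has derivative 0 and constant coefficient 1; as positive integers are
    units, it equals 1. *)
Lemma fps_logd_inj f f' g : (forall n, n.+1%:R \is a @GRing.unit A) ->
  fps_logd f g -> fps_logd f' g -> f = f'.
Proof.
move=> Unat log_f log_f'; have [h1 dh] := fps_logdM log_f (fps_logdV log_f').
rewrite -[f](divrK (fps_logd_unit log_f')) -[RHS]mul1r; congr (_ * _).
apply/fpsP => -[//|n]; apply: (mulIr (Unat n)).
move: dh; rewrite subrr mulr0 => /fpsP /(_ n); rewrite /= => dh.
by rewrite mulr_natr mul0r.
Qed.

Lemma fps_coefXM f n :
  fps_coef (fps_var A * f) n = if n is m.+1 then fps_coef f m else 0.
Proof.
rewrite /=; case: n => [|n]; first by rewrite big_ord1 mul0r.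
rewrite !big_ord_recl big1 ?addr0 => [|i _]; rewrite mul0r ?add0r //.
by rewrite mul1r subSS subn0.
Qed.

Lemma fps_coefCM a f n : fps_coef (fps_const a * f) n = a * fps_coef f n.
Proof.
by rewrite /= big_ord_recl big1 ?addr0 ?subn0 // => i _; rewrite mul0r.
Qed.

Lemma fps_coef_linearM a f n :
  fps_coef ((1 - fps_const a * fps_var A) * f) n =
  fps_coef f n - (if n is m.+1 then a * fps_coef f m else 0).
Proof.
rewrite mulrBl mul1r -mulrA; congr (_ - _).
by rewrite fps_coefCM fps_coefXM; case: n; rewrite ?mulr0.
Qed.

(** The series is the geometric expansion of [- a / (1 - a z)]. *)
Lemma fps_logd_linear a :
  fps_logd (1 - fps_const a * fps_var A) (Fps (fun n => - a ^+ n.+1)).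
Proof.
split; first by rewrite -[1 - _]mulr1 fps_coef_linearM /= subr0.
rewrite -[X in fps_deriv X]mulr1; apply/fpsP => n.
rewrite -[LHS]/(fps_coef _ n.+1 *+ n.+1) !fps_coef_linearM /=.
case: n => [|n]; rewrite ?mulr1 ?subr0 ?sub0r ?expr1 //.
by rewrite mulr0 oppr0 mul0rn mulrN -exprS subrr.
Qed.

Variables (r : nat) (x : A).
Hypothesis Unat : forall n, n.+1%:R \is a @GRing.unit A.

Definition det_fps : fps A := Fps (fun n => n`!%:R^-1 * det_perm_sum r x n).

(** Since [n ^_ k * (n - k)! = n!], dividing [det_perm_sum_rec] by [n!] turns it into a Cauchy
    product. *)
Lemma fps_logd_det : fps_logd det_fps (Fps (fun n => (1 - x ^+ n.+1) ^+ r)).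
Proof.
have Ufact n : n`!%:R \is a @GRing.unit A.
  by elim: n => [|n IHn]; rewrite ?unitr1 // factS natrM unitrM Unat.
split.
  rewrite /= invr1 mul1r /det_perm_sum (big_pred1 1%g) => [|s].
    by rewrite /det_perm det_mx00 expr1n.
  by apply/esym/eqP/permP => -[].
rewrite mulrC; apply/fpsP => n /=.
rewrite -[LHS]mulr_natr factS natrM invrM // mulrAC divrK //.
rewrite det_perm_sum_rec mulr_sumr; apply: eq_bigr => k _.
rewrite -mulrnAr mulrCA; congr (_ * _).
rewrite -[_ *+ n ^_ k]mulr_natl mulrA; congr (_ * _).
apply: (mulrI (Ufact n)).
rewrite mulVKr // -(ffact_fact (n := n) (m := k)) -1?ltnS // natrM.
by rewrite mulrK.
Qed.

Lemma det_fpsE : det_fps = \prod_(k < r.+1)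
  (1 - fps_const (x ^+ k) * fps_var A) ^ ((-1) ^+ k.+1 * ('C(r, k))%:Z).
Proof.
apply: (fps_logd_inj Unat fps_logd_det).
have := fps_logd_prod r.+1 (fun k =>
  fps_logdX ((-1) ^+ k.+1 * ('C(r, k))%:Z) (fps_logd_linear (x ^+ k))).
congr (fps_logd _ _); apply/fpsP => n.
have coef_is_zmod : zmod_morphism (fun f => fps_coef f n) by [].
pose coefn : {additive fps A -> A} := HB.pack (fun f => fps_coef f n)
  (GRing.isZmodMorphism.Build _ _ _ coef_is_zmod).
(* The extra sign in [(-1) ^+ k.+1] cancels that of [- (x ^+ k) ^+ n.+1], leaving the [k]-th
   binomial term of [(1 - x ^+ n.+1) ^+ r]. *)
rewrite -[LHS]/(coefn _) raddf_sum [RHS]/= exprBn; apply: eq_bigr => k _.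
rewrite expr1n mulr1 raddfMz /= [(-1) ^+ _]exprS mulN1r mulNr mulrNz mulNrz opprK.
rewrite -mulrzr intrM rmorphXn rmorphN1 -exprM mulnC exprM.
by rewrite mulrA [_ ^+ k * _]mulrC mulr_natr.
Qed.

End FpsLog.

Lemma fsbig_ord_supp (V : eqType) (idx : V) (op : Monoid.com_law idx) n
    (F : nat -> V) : (forall k, (n <= k)%N -> F k = idx) ->
  \big[op/idx]_(k \in [set: nat]) F k = \big[op/idx]_(k < n) F k.
Proof.
move=> F0; rewrite fsbig_ord; apply/esym/fsbig_widen => // k [_ /negP].
by rewrite -leqNgt; apply: F0.
Qed.

(** * Sums of complex power series under multiplication and division by linear factors *)

Section PowerSeries.
Variable R : realType.
Implicit Types (f : fps R[i]) (a q z l : R[i]).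

Lemma near_expr_mul_lt q (c eps : R[i]) : `|q| < 1 -> 0 <= c -> 0 < eps ->
  \forall k \near \oo, `|q| ^+ k * c < eps.
Proof.
move=> q1 c0 eps0.
have realE (t : R[i]) : 0 <= t -> t = (complex.Re t)%:C%C.
  by move=> t0; rewrite RRe_real // ger0_real.
have := q1; have := c0; have := eps0; have := normr_ge0 q.
rewrite (realE _ (normr_ge0 q)) (realE _ c0) (realE _ (ltW eps0)).
move: (complex.Re _) (complex.Re c) (complex.Re eps) => {c0 eps0 q1} p c' e.
rewrite !(lecR, ltcR) => p0 e0 c'0 p1.
(* Dividing by [c' + 1] covers the case [c' = 0]. *)
have c'1 : 0 < c' + 1 by rewrite ltr_wpDl.
have /cvgrPdist_lt /(_ (e / (c' + 1))) : (GRing.exp p : R ^nat) @ \oo --> 0.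
  by apply: cvg_expr; rewrite ger0_norm.
rewrite divr_gt0 // => /(_ isT); apply: filterS => k.
rewrite sub0r normrN ger0_norm ?exprn_ge0 // ltr_pdivlMr // => pk.
rewrite -rmorphXn -rmorphM ltcR (le_lt_trans _ pk) //.
by rewrite ler_wpM2l ?exprn_ge0 // lerDl.
Qed.

(** The error [l - e n] is multiplied by [q] at each step, up to a term tending to 0, so it dies out
    geometrically. *)
Lemma cvg_contraction q l (e : nat -> R[i]) : `|q| < 1 ->
  (fun n => e n.+1 - q * e n) @ \oo --> ((1 - q) * l : R[i]^o) ->
  e @ \oo --> (l : R[i]^o).
Proof.
move=> q1 /(@cvgrPdist_lt _ (R[i]^o)) de_l.
apply/(@cvgrPdist_lt _ (R[i]^o)) => eps eps0.
have eps2 : 0 < eps / 2 by rewrite divr_gt0.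
(* With this tolerance, [eps / 2] is the fixed point of the bound
   [t -> |q| t + (1 - |q|) eps / 2]. *)
have [|N _ Nde] := de_l (eps / 2 * (1 - `|q|)).
  by rewrite mulr_gt0 // subr_gt0.
have eN k : `|l - e (N + k)%N| <= `|q| ^+ k * `|l - e N| + eps / 2.
  elim: k => [|k IHk]; first by rewrite addn0 expr0 mul1r lerDl ltW.
  have := ler_wpM2l (normr_ge0 q) IHk; rewrite mulrDr mulrA -exprS => le_qe.
  have /ltW le_de := Nde (N + k)%N (leq_addr _ _).
  have -> : l - e (N + k.+1)%N = (1 - q) * l - (e (N + k).+1 - q * e (N + k)%N)
      + q * (l - e (N + k)%N) by rewrite addnS; ring.
  rewrite (le_trans (ler_normD _ _)) // normrM.
  rewrite (le_trans (lerD le_de le_qe)) // addrCA lerD2l mulrBr mulr1.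
  by rewrite [_ * `|q|]mulrC subrK.
have [M _ Mq] := near_expr_mul_lt q1 (normr_ge0 (l - e N)) eps2.
exists (N + M)%N => // n /= le_n.
have le_Nn : (N <= n)%N by apply: leq_trans le_n; apply: leq_addr.
rewrite -(subnKC le_Nn) (le_lt_trans (eN _)) // [ltRHS]splitr ltrD2r.
by apply: Mq; rewrite /= leq_subRL.
Qed.

Definition fps_sums_to f z l :=
  series (fun n => fps_coef f n * z ^+ n) @ \oo --> (l : R[i]^o).

Lemma series_linearM a f z n :
  series (fun m => fps_coef ((1 - fps_const a * fps_var _) * f) m * z ^+ m) n.+1 =
  series (fun m => fps_coef f m * z ^+ m) n.+1
  - a * z * series (fun m => fps_coef f m * z ^+ m) n.
Proof.
have seriesS (u : nat -> R[i]) k : series u k.+1 = series u k + u k.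
  by rewrite /series /= big_nat_recr.
have series0 (u : nat -> R[i]) : series u 0%N = 0 by rewrite /series /= big_geq.
elim: n => [|n IHn].
  by rewrite !seriesS fps_coef_linearM !series0 mulr0 !subr0.
rewrite [LHS]seriesS IHn fps_coef_linearM !seriesS exprS.
ring.
Qed.

Lemma fps_sums_to_linearM a f z l :
  fps_sums_to f z l ->
  fps_sums_to ((1 - fps_const a * fps_var _) * f) z ((1 - a * z) * l).
Proof.
move=> f_l; rewrite /fps_sums_to -(@cvg_shiftS (R[i]^o)).
under eq_fun do rewrite series_linearM.
rewrite mulrBl mul1r; apply: cvgB; first by rewrite (@cvg_shiftS (R[i]^o)).
by apply: cvgMr.
Qed.

(** Convergence for [f] itself is a conclusion: its partial sums satisfy the recurrence of
    [cvg_contraction] with [q = a z]. *)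
Lemma fps_sums_to_linearV a f z l : `|a * z| < 1 ->
  fps_sums_to ((1 - fps_const a * fps_var _) * f) z ((1 - a * z) * l) ->
  fps_sums_to f z l.
Proof.
move=> az1; rewrite /fps_sums_to -(@cvg_shiftS (R[i]^o)) => f_l.
apply: (cvg_contraction az1); apply: cvg_trans f_l; apply: near_eq_cvg.
by apply: nearW => n; rewrite -series_linearM.
Qed.

Lemma fps_sums_toX a f z l (e : int) : `|a * z| < 1 ->
  fps_sums_to f z l ->
  fps_sums_to ((1 - fps_const a * fps_var _) ^ e * f) z ((1 - a * z) ^ e * l).
Proof.
move=> az1 f_l; case: e => n.
  elim: n => [|n IHn]; first by rewrite !expr0z !mul1r.
  by rewrite -!exprnP !exprS -!mulrA; apply: fps_sums_to_linearM.
have UL := fps_logd_unit (fps_logd_linear a).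
have Uaz : 1 - a * z \is a GRing.unit.
  rewrite unitfE subr_eq0; apply: contraTneq az1 => <-.
  by rewrite normr1 ltxx.
have mulVexprS (B : comUnitRingType) (u v : B) m :
    u \is a GRing.unit -> u * (u ^- m.+1 * v) = u ^- m * v.
  by move=> Uu; rewrite exprSr invrM ?unitrX // mulrA mulVKr.
rewrite NegzE -!exprnN; elim: n.+1 => {n}[|n IHn].
  by rewrite !expr0 !invr1 !mul1r.
(* Multiplying the series and its sum by one linear factor gives back the induction hypothesis. *)
apply: (fps_sums_to_linearV az1).
by rewrite !mulVexprS.
Qed.

Lemma fps_sums_to_prod n (a : nat -> R[i]) (e : nat -> int) z :
  (forall k, `|a k * z| < 1) ->
  fps_sums_to (\prod_(k < n) (1 - fps_const (a k) * fps_var _) ^ e k) z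
    (\prod_(k < n) (1 - a k * z) ^ e k).
Proof.
move=> az1; elim: n => [|n IHn].
  (* The partial sums of the series 1 are constant only from index 1 on, hence the shift. *)
  rewrite !big_ord0 /fps_sums_to -(@cvg_shiftS (R[i]^o)).
  rewrite (_ : (fun n => _) = cst 1); first exact: cvg_cst.
  apply/funext => n; rewrite /series /= big_nat_recl //= expr0 mulr1.
  by rewrite big1 ?addr0 // => i _; rewrite mul0r.
rewrite !big_ord_recr /= [X in fps_sums_to X]mulrC [X in fps_sums_to _ _ X]mulrC.
exact: fps_sums_toX.
Qed.

End PowerSeries.

(** * The formal and the analytic identity *)

Theorem theorem5p27 (r : nat) :
  (forall F : fieldType, [pchar F] =i pred0 ->
    \big[*%R/1]_(k \in [set: nat])
       (1 - fps_const ('X^k) * fps_var {poly F})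
          ^ ((-1) ^+ k.+1 * ('C(r, k))%:Z)
    = Fps (fun n => \sum_(s : 'S_n)
             (n`!%:R : F)^-1 *: \det (1%:M - 'X *: perm_mx s) ^+ r))
  /\
  (forall R : realType, exists2 d : R, 0 < d &
    forall x z : R[i], `|x| < d%:C%C -> `|z| < d%:C%C ->
      series (fun n => \sum_(s : 'S_n)
                z ^+ n / n`!%:R * \det (1%:M - x *: perm_mx s) ^+ r) @ \oo
      --> (\big[*%R/1]_(k \in [set: nat])
             (1 - x ^+ k * z) ^ ((-1) ^+ k.+1 * ('C(r, k))%:Z) : R[i]^o)).
Proof.
(* Exponents vanish beyond [r], so both infinite products are finite. *)
have bin0 k : (r.+1 <= k)%N -> (-1) ^+ k.+1 * ('C(r, k))%:Z = 0.
  by move=> /bin_small ->; rewrite mulr0.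
split=> [F /pcharf0P charF | R].
  rewrite (@fsbig_ord_supp _ _ _ r.+1) => [|k /bin0 -> //].
  rewrite -det_fpsE => [|n]; last first.
    by rewrite -polyC_natr rmorph_unit // unitfE charF.
  apply/fpsP => n /=; rewrite mulr_sumr; apply: eq_bigr => s _.
  by rewrite -det_perm_const -mul_polyC -polyCV polyC_natr.
(* Radius 1 works: it forces [|x ^+ k * z| < 1] for every [k]. *)
exists 1 => // x z x1 z1.
rewrite (@fsbig_ord_supp _ _ _ r.+1) => [|k /bin0 -> //].
have az1 k : `|x ^+ k * z| < 1.
  by rewrite normrM (le_lt_trans _ z1) // ler_piMl // normrX exprn_ile1 // ltW.
have := @fps_sums_to_prod _ r.+1 _ (fun k => (-1) ^+ k.+1 * ('C(r, k))%:Z) _ az1.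
(* The formal identity is used with coefficients in [R[i]], where [x] is a number. *)
rewrite -det_fpsE => [|n]; last by rewrite unitfE pnatr_eq0.
apply: cvg_trans; apply: near_eq_cvg; apply: nearW => m.
congr (series _ m); apply/funext => n; rewrite /= mulr_sumr mulr_suml.
apply: eq_bigr => s _.
by rewrite -det_perm_const mulrC mulrA.
Qed.
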